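(* Every Taylor graph is pseudo-vertex-transitive.
   Context: A Taylor graph is a distance-regular graph with intersection array $\{k,b,1;1,b,k\}$ where $b<k-1$; it has diameter $D=3$. Let $\Gamma$ have vertex set $X$, distance $\partial$, adjacency matrix $A$, and $V=\mathbb{C}^X$. For $x\in X$ and $0\le i\le D$ let $E^*_i(x)$ be the diagonal matrix with $(E^*_i(x))_{yy}=1$ if $\partial(x,y)=i$ and $0$ otherwise. The Terwilliger algebra $T(x)$ is the subalgebra of $\mathrm{Mat}_X(\mathbb{C})$ generated by $A,E^*_0(x),\dots,E^*_D(x)$. The graph $\Gamma$ is pseudo-vertex-transitive if for all $x,y\in X$: (i) there is a $\mathbb{C}$-algebra isomorphism $T(x)\to T(y)$ sending $A\mapsto A$ and $E^*_i(x)\mapsto E^*_i(y)$ for all $i$; and (ii) there is a $\mathbb{C}$-linear bijection $\rho:V\to V$ with $\rho A=A\rho$ and $\rho E^*_i(x)=E^*_i(y)\rho$ for all $i$. *)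

(* Defs.v *)
From mathcomp Require Import all_boot all_algebra.
From mathcomp Require Import complex.
From mathcomp Require Import Rstruct.
Set Implicit Arguments. Unset Strict Implicit. Unset Printing Implicit Defensive.
Import GRing.Theory Num.Theory.
Local Open Scope ring_scope.

Definition Cx : numClosedFieldType := (Rdefinitions.R)[i]%C.

Definition simple_graph (n : nat) (adj : rel 'I_n) : Prop :=
  symmetric adj /\ irreflexive adj.

Fixpoint ball (n : nat) (adj : rel 'I_n) (k : nat) (x : 'I_n) : {set 'I_n} :=
  match k with
  | 0 => [set x]
  | k'.+1 => ball adj k' x :|: [set z | [exists w in ball adj k' x, adj w z]]
  end.

Definition gconnected (n : nat) (adj : rel 'I_n) : Prop :=
  forall x y : 'I_n, exists k, y \in ball adj k x.

(* path-length distance (least k with y in ball k x); meaningful for connected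
   graphs, where every distance is < n *)
Definition dist (n : nat) (adj : rel 'I_n) (x y : 'I_n) : nat :=
  find (fun k => y \in ball adj k x) (iota 0 n).

Definition distance_regular_array (n : nat) (adj : rel 'I_n) (D : nat)
    (bs cs : nat -> nat) : Prop :=
  [/\ gconnected adj,
      (forall x y, dist adj x y <= D)%N,
      (exists x y, dist adj x y = D) &
      forall x y, let i := dist adj x y in
        ((i < D)%N -> #|[set z | adj y z & dist adj x z == i.+1]| = bs i) /\
        ((0 < i)%N -> #|[set z | adj y z & dist adj x z == i.-1]| = cs i) ].

Definition taylor_graph (n : nat) (adj : rel 'I_n) (k b : nat) : Prop :=
  [/\ simple_graph adj,
      distance_regular_array adj 3 (nth 0%N [:: k; b; 1%N]) (nth 0%N [:: 0%N; 1%N; b; k]) &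
      (b < k - 1)%N ].

Definition Amx (n : nat) (adj : rel 'I_n) : 'M[Cx]_n :=
  \matrix_(i, j) (adj i j)%:R.

Definition Estar (n : nat) (adj : rel 'I_n) (x : 'I_n) (i : nat) : 'M[Cx]_n :=
  \matrix_(y, z) ((y == z) && (dist adj x y == i))%:R.

Inductive inTer (n : nat) (adj : rel 'I_n) (D : nat) (x : 'I_n) : 'M[Cx]_n -> Prop :=
  | inTer_A : inTer adj D x (Amx adj)
  | inTer_E i : (i <= D)%N -> inTer adj D x (Estar adj x i)
  | inTer_1 : inTer adj D x 1%:M
  | inTer_add M N : inTer adj D x M -> inTer adj D x N -> inTer adj D x (M + N)
  | inTer_scale (a : Cx) M : inTer adj D x M -> inTer adj D x (a *: M)
  | inTer_mul M N : inTer adj D x M -> inTer adj D x N -> inTer adj D x (M *m N).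

Definition Ter_iso (n : nat) (adj : rel 'I_n) (D : nat) (x y : 'I_n) : Prop :=
  exists phi : 'M[Cx]_n -> 'M[Cx]_n,
    [/\ forall M, inTer adj D x M -> inTer adj D y (phi M),
        forall (a : Cx) M N, inTer adj D x M -> inTer adj D x N ->
          phi (a *: M + N) = a *: phi M + phi N,
        forall M N, inTer adj D x M -> inTer adj D x N ->
          phi (M *m N) = phi M *m phi N,
        phi 1%:M = 1%:M &
        [/\ forall M N, inTer adj D x M -> inTer adj D x N -> phi M = phi N -> M = N,
            forall N, inTer adj D y N -> exists2 M, inTer adj D x M & phi M = N,
            phi (Amx adj) = Amx adj &
            forall i, (i <= D)%N -> phi (Estar adj x i) = Estar adj y i ] ].

(* (ii): a C-linear bijection rho of V = C^X (an invertible matrix acting on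
   column vectors) with rho A = A rho and rho E*_i(x) = E*_i(y) rho *)
Definition module_iso (n : nat) (adj : rel 'I_n) (D : nat) (x y : 'I_n) : Prop :=
  exists rho : 'M[Cx]_n,
    [/\ rho \in unitmx,
        rho *m Amx adj = Amx adj *m rho &
        forall i, (i <= D)%N -> rho *m Estar adj x i = Estar adj y i *m rho ].

Definition pseudo_vertex_transitive (n : nat) (adj : rel 'I_n) (D : nat) : Prop :=
  forall x y : 'I_n, Ter_iso adj D x y /\ module_iso adj D x y.

(* Main.v *)
(* A Taylor graph is an antipodal double cover of a complete graph. Let P be the
   antipodal involution. On the (+1)-eigenspace of P the adjacency matrix A is
   that of the complete graph; on the (-1)-eigenspace it satisfies
   A^2 = (k - 1 - 2b) A + k, hence has two eigenvalues r, s, and r, s avoid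
   0, 1, -1 because 0 < b < k - 1. For t_x = e_x - P e_x the components of
   t_x - t_y in the two eigenspaces of A are therefore anisotropic, and the
   product H of the two Householder reflections in them commutes with A and P
   and sends t_x to t_y.

   Let D_x be the diagonal matrix which is 1 at distance at most 1 from x and -1
   elsewhere. It exchanges the eigenspaces of P, so
   rho = (H (1 - P) + D_y H (1 - P) D_x) / 2 is H on the (-1)-eigenspace and its
   transport by D_x, D_y on the (+1)-eigenspace. It is orthogonal and intertwines
   A, P, D_x with A, P, D_y and e_x with e_y, and the matrices E*_i(x) are
   expressible in P, D_x and e_x. The algebra isomorphism is conjugation by
   rho. *)
Require Import Defs.
From mathcomp Require Import all_boot all_order all_algebra.
From mathcomp Require Import zify ring.

Set Implicit Arguments.
Unset Strict Implicit.
Unset Printing Implicit Defensive.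

(** * Balls and the path-length distance *)

Section Distance.

Variables (n : nat) (adj : rel 'I_n).
Hypothesis adj_sym : symmetric adj.
Implicit Types (x y z : 'I_n) (i j : nat).

Lemma mem_ballS j x y :
  (y \in ball adj j.+1 x) =
  (y \in ball adj j x) || [exists w in ball adj j x, adj w y].
Proof. by rewrite /= !inE. Qed.

Lemma ball_mono i j x : i <= j -> ball adj i x \subset ball adj j x.
Proof.
move=> /subnK <-; elim: (j - i) => [|m IH] //=.
exact: subset_trans IH (subsetUl _ _).
Qed.

Lemma ball_cons j x w y : adj x w -> y \in ball adj j w -> y \in ball adj j.+1 x.
Proof.
move=> xw; elim: j y => [|j IH] y.
  rewrite inE => /eqP->; rewrite mem_ballS; apply/orP; right.
  by apply/existsP; exists x; rewrite inE eqxx.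
rewrite (mem_ballS j w y) => /orP[/IH yj|/existsP[z /andP[/IH zj zy]]].
  by rewrite mem_ballS yj.
by rewrite mem_ballS; apply/orP; right; apply/existsP; exists z; rewrite zj.
Qed.

Lemma ball_sym j x y : (y \in ball adj j x) = (x \in ball adj j y).
Proof.
suff H a c : c \in ball adj j a -> a \in ball adj j c by apply/idP/idP; apply: H.
elim: j c => [|j IH] c; first by rewrite !inE eq_sym.
rewrite (mem_ballS j a c) => /orP[/IH H|/existsP[w /andP[/IH wj wc]]].
  by rewrite mem_ballS H.
by apply: ball_cons wj; rewrite adj_sym.
Qed.

(** The search in [dist] returns [n] when it fails, so this bound says that it always succeeds;
    [dist] is then the least radius of a ball containing the vertex. *)
Hypothesis dist_lt : forall x y, dist adj x y < n.

Lemma mem_ball j x y : (y \in ball adj j x) = (dist adj x y <= j).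
Proof.
apply/idP/idP => [yj|lej].
  rewrite leqNgt; apply/negP => ltj.
  have := @before_find _ 0 (fun k => y \in ball adj k x) (iota 0 n) j ltj.
  by rewrite nth_iota ?add0n ?yj // (ltn_trans ltj).
have hasy : has (fun k => y \in ball adj k x) (iota 0 n).
  by rewrite has_find size_iota; apply: dist_lt.
have := nth_find 0 hasy; rewrite nth_iota ?add0n; last exact: dist_lt.
exact/subsetP/ball_mono.
Qed.

Lemma dist_sym x y : dist adj x y = dist adj y x.
Proof.
by apply/eqP; rewrite eqn_leq -!mem_ball ball_sym mem_ball leqnn ball_sym mem_ball leqnn.
Qed.

Lemma dist_eq0 x y : (dist adj x y == 0) = (x == y).
Proof. by rewrite -leqn0 -mem_ball inE eq_sym. Qed.

Lemma dist_adj x y z : adj y z -> dist adj x z <= (dist adj x y).+1.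
Proof.
move=> yz; rewrite -mem_ball mem_ballS; apply/orP; right.
by apply/existsP; exists y; rewrite mem_ball leqnn.
Qed.

Lemma dist_eqS i x z :
  dist adj x z = i.+1 -> exists2 y, adj y z & dist adj x y = i.
Proof.
move=> xz; have: z \in ball adj i.+1 x by rewrite mem_ball xz.
rewrite mem_ballS mem_ball xz ltnn => /existsP[y /andP[]].
rewrite mem_ball => yi yz; exists y => //.
by have := dist_adj x yz; lia.
Qed.

Hypothesis adj_irr : irreflexive adj.

Lemma dist_eq1 x y : (dist adj x y == 1) = adj x y.
Proof.
apply/eqP/idP => [/dist_eqS[z zy /eqP]|xy].
  by rewrite dist_eq0 => /eqP->.
have := dist_adj x xy; have /eqP-> : dist adj x x == 0 by rewrite dist_eq0.
have : dist adj x y != 0 by rewrite dist_eq0; apply: contraTneq xy => ->; rewrite adj_irr.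
by lia.
Qed.

(** Double counting of the adjacent pairs with one vertex in each sphere; it yields the sphere sizes
    of a Taylor graph. *)
Lemma card_neighbors_between i j (x : 'I_n) :
  \sum_(y | dist adj x y == i) #|[set z | adj y z & dist adj x z == j]| =
  \sum_(z | dist adj x z == j) #|[set y | adj z y & dist adj x y == i]|.
Proof.
transitivity (\sum_(y | dist adj x y == i) \sum_(z | dist adj x z == j) adj y z).
  apply: eq_bigr => y _; rewrite -sum1dep_card big_mkcondl.
  by apply: eq_bigr => z _; case: (adj y z).
rewrite exchange_big; apply: eq_bigr => z _; rewrite -sum1dep_card big_mkcondl.
by apply: eq_bigr => y _; rewrite adj_sym; case: (adj z y).
Qed.

End Distance.

(** * Combinatorics of Taylor graphs: antipodes and common neighbours *)

Lemma taylor_dist_lt n (adj : rel 'I_n) k b (x y : 'I_n) :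
  taylor_graph adj k b -> dist adj x y < n.
Proof.
move=> [_ [_ dist3 [u [v uv]] reg] bk].
(* It remains to find four vertices: [u], [v] and the [k >= 2] elements of [S] are distinct, being
   at values 0, 3 and 2 of [dist adj u]. *)
apply: (leq_ltn_trans (dist3 x y)).
have [_] := reg u v; rewrite uv /= => /(_ isT) card2.
have du : dist adj u u = 0.
  have n_gt0 : 0 < n := leq_ltn_trans (leq0n _) (ltn_ord u).
  by rewrite /dist -[X in iota 0 X](prednK n_gt0) /= inE eqxx.
set S := [set z | _ & _] in card2.
have vS : v \notin S by rewrite inE uv andbF.
have uS : u \notin v |: S.
  by rewrite !inE du andbF orbF; apply/eqP => uv'; rewrite -uv' du in uv.
have := max_card (mem (u |: (v |: S))).
rewrite card_ord !cardsU1 vS uS card2; lia.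
Qed.

Section TaylorGraph.

Variables (n : nat) (adj : rel 'I_n) (k b : nat).
Hypothesis taylor : taylor_graph adj k b.
Local Notation d := (dist adj).
Implicit Types x y z : 'I_n.

Lemma taylor_adj_sym : symmetric adj. Proof. by case: taylor => [[]]. Qed.

Lemma taylor_adj_irr : irreflexive adj. Proof. by case: taylor => [[]]. Qed.

Let dist_lt x y : d x y < n := taylor_dist_lt x y taylor.
Let d_sym := dist_sym taylor_adj_sym dist_lt.
Let d_eq0 := dist_eq0 dist_lt.
Let d_eq1 := dist_eq1 dist_lt taylor_adj_irr.

Lemma taylor_dist_le3 x y : d x y <= 3.
Proof. by case: taylor => _ [_ H _ _] _; apply: H. Qed.

Lemma card_away i x y : d x y = i -> i < 3 ->
  #|[set z | adj y z & d x z == i.+1]| = nth 0 [:: k; b; 1] i.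
Proof. by case: taylor => _ [_ _ _ reg] _ <-; case: (reg x y). Qed.

Lemma card_towards i x y : d x y = i.+1 ->
  #|[set z | adj y z & d x z == i]| = nth 0 [:: 1; b; k] i.
Proof.
case: taylor => _ [_ _ _ reg] _ xy.
by have [_] := reg x y; rewrite xy => /(_ isT).
Qed.

Lemma taylor_k_gt : b.+1 < k.
Proof. by case: taylor => _ _; lia. Qed.

(** For [w] at distance 2 from [u], [b] counts the neighbours of [w] at distance 1 from [u]; the
    last step of a geodesic to [w] provides one. *)
Lemma taylor_b_gt0 : 0 < b.
Proof.
have [_ [_ _ [u [v /(dist_eqS dist_lt)[w _ uw]]] _] _] := taylor.
have := card_towards uw => /= <-.
have [z zw /eqP uz] := dist_eqS dist_lt uw.
by apply/card_gt0P; exists z; rewrite inE taylor_adj_sym zw.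
Qed.

Lemma taylor_valency x : #|[set z | adj x z]| = k.
Proof.
have /eqP xx : d x x == 0 by rewrite d_eq0.
rewrite -[RHS](card_away xx isT); apply: eq_card => z.
by rewrite !inE d_eq1 andbb.
Qed.

(** Between the spheres of radii 1 and 2 every vertex has [b] neighbours on the other side, so the
    spheres have equal size. *)
Lemma card_sphere2 x : #|[set z | d x z == 2]| = k.
Proof.
have := card_neighbors_between taylor_adj_sym 1 2 x.
under eq_bigr => y /eqP H do rewrite (card_away H isT) /=.
under [RHS]eq_bigr => y /eqP H do rewrite (card_towards H) /=.
rewrite !sum_nat_cond_const => /eqP.
rewrite eqn_pmul2r ?taylor_b_gt0 // => /eqP.
have -> : #|[set y | d x y == 1]| = k.
  by rewrite -(taylor_valency x); apply: eq_card => z; rewrite !inE d_eq1.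
by [].
Qed.

Lemma card_sphere3 x : #|[set z | d x z == 3]| = 1.
Proof.
have := card_neighbors_between taylor_adj_sym 2 3 x.
under eq_bigr => y /eqP H do rewrite (card_away H isT) /=.
under [RHS]eq_bigr => y /eqP H do rewrite (card_towards H) /=.
rewrite !sum_nat_cond_const card_sphere2.
(* The edge count reads [k * 1 = m * k], with [m] the size of the sphere of radius 3. *)
by have := taylor_k_gt; nia.
Qed.

(** In a Taylor graph the default is never taken, because the sphere of radius 3 is a singleton. *)
Definition antipode x : 'I_n := odflt x [pick y | d x y == 3].

Lemma dist_eq3 x y : (d x y == 3) = (y == antipode x).
Proof.
have /eqP/cards1P[y0 Hy0] := card_sphere3 x.
have E z : (d x z == 3) = (z == y0) by rewrite -in_set1 -Hy0 inE.
rewrite E /antipode; case: pickP => [z|/(_ y0)]; rewrite E ?eqxx //=.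
by move=> /eqP->.
Qed.

Lemma antipodeK : involutive antipode.
Proof. by move=> x; apply/esym/eqP; rewrite -dist_eq3 d_sym dist_eq3. Qed.

(** All [k] neighbours of the antipode are at distance 2 from [x], since that count already equals
    the valency. Conversely, a vertex at distance 2 has exactly one neighbour at distance 3, which
    must be the antipode. *)
Lemma adj_antipode x y : adj (antipode x) y = (d x y == 2).
Proof.
have /eqP x3 : d x (antipode x) == 3 by rewrite dist_eq3.
have sub : [set z | adj (antipode x) z & d x z == 2] \subset [set z | adj (antipode x) z].
  by apply/subsetP => z; rewrite !inE => /andP[].
have := subset_leqif_cards sub.
rewrite (card_towards x3) taylor_valency /= => -[_]; rewrite eqxx => /esym/eqP/setP/(_ y).
rewrite !inE; case: eqP => [y2|_]; last by rewrite andbF.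
move=> _; have /eqP/cards1P[z /setP/(_ z)] := card_away y2 isT.
by rewrite !inE eqxx dist_eq3 => /andP[+ /eqP zE]; rewrite zE taylor_adj_sym.
Qed.

Lemma dist_antipode x y : d (antipode x) y = 3 - d x y.
Proof.
have := taylor_dist_le3 x y; case E: (d x y) => [|[|[|[|//]]]] _ /=; apply/eqP.
- move/eqP: E; rewrite d_eq0 => /eqP<-.
  by rewrite dist_eq3 antipodeK.
- by rewrite -adj_antipode antipodeK -d_eq1 E.
- by rewrite d_eq1 adj_antipode E.
- by move/eqP: E; rewrite d_eq0 dist_eq3 eq_sym.
Qed.

Lemma card_common_neighbors x y :
  #|[set z | adj x z && adj z y]| = nth 0 [:: k; k - b - 1; b; 0] (d x y).
Proof.
have -> : [set z | adj x z && adj z y] = [set z | adj y z & d x z == 1].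
  by apply/setP => z; rewrite !inE d_eq1 andbC taylor_adj_sym.
have := taylor_dist_le3 x y; case E: (d x y) => [|[|[|[|//]]]] _ /=.
- exact: card_away E isT.
(* The [k] neighbours of [y] lie at distance 0, 1 or 2 from [x], with one at distance 0 and [b] at
   distance 2. *)
- have := taylor_valency y.
  rewrite -(cardsID [set z | d x z == 1]) -(cardsID [set z | d x z == 2] (_ :\: _)).
  have -> : [set z | adj y z] :&: [set z | d x z == 1] = [set z | adj y z & d x z == 1].
    by apply/setP => z; rewrite !inE.
  have -> : ([set z | adj y z] :\: [set z | d x z == 1]) :&: [set z | d x z == 2]
         = [set z | adj y z & d x z == 2].
    by apply/setP => z; rewrite !inE; case: eqP => [->|]; rewrite ?andbF.
  rewrite (card_away E isT) /=.
  have -> : [set z | adj y z] :\: [set z | d x z == 1] :\: [set z | d x z == 2]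
         = [set z | adj y z & d x z == 0].
    apply/setP => z; rewrite !inE; case: (boolP (adj y z)) => [yz|_]; rewrite ?andbF //=.
    by have := dist_adj dist_lt x yz; rewrite E; case: (d x z) => [|[|[|]]].
  by rewrite (card_towards E) /=; lia.
- exact: card_towards E.
- apply/eqP; rewrite cards_eq0; apply/eqP/setP => z; rewrite !inE.
  move/eqP: E; rewrite dist_eq3 => /eqP->; rewrite adj_antipode.
  by case: eqP => [->|].
Qed.

End TaylorGraph.

Import Order.TTheory GRing.Theory Num.Theory.
Local Open Scope ring_scope.

(** * Householder reflections for a symmetric bilinear form *)

Section Reflections.

Variables (F : fieldType) (n : nat).
Implicit Types (p u v d t : 'cV[F]_n) (A B P : 'M[F]_n) (r s : F).

(** Bilinear, without conjugation even over the complex numbers: nonzero vectors can be isotropic,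
    so each reflection needs [dotv p p != 0]. *)
Definition dotv u v : F := (u^T *m v) 0 0.

Lemma mul_dotv p u v : p *m (u^T *m v) = dotv u v *: p.
Proof. by rewrite [u^T *m v]mx11_scalar mul_mx_scalar. Qed.

Lemma dotvC u v : dotv u v = dotv v u.
Proof. by rewrite /dotv -[RHS]trace_mx11 -mxtrace_tr trmx_mul trmxK trace_mx11. Qed.

Lemma dotvBl u v w : dotv (u - v) w = dotv u w - dotv v w.
Proof. by rewrite /dotv raddfB mulmxBl !mxE. Qed.

Lemma dotvBr u v w : dotv w (u - v) = dotv w u - dotv w v.
Proof. by rewrite !(dotvC w) dotvBl. Qed.

Lemma dotvZl a u v : dotv (a *: u) v = a * dotv u v.
Proof. by rewrite /dotv linearZ /= -scalemxAl mxE. Qed.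

Lemma dotvZr a u v : dotv u (a *: v) = a * dotv u v.
Proof. by rewrite !(dotvC u) dotvZl. Qed.

Lemma dotvM A u v : dotv (A *m u) v = dotv u (A^T *m v).
Proof. by rewrite /dotv trmx_mul mulmxA. Qed.

Definition reflection p : 'M[F]_n := 1%:M - (2 / dotv p p) *: (p *m p^T).

Lemma reflectionE p v :
  reflection p *m v = v - (2 / dotv p p * dotv p v) *: p.
Proof.
by rewrite mulmxBl mul1mx -scalemxAl -mulmxA mul_dotv scalerA.
Qed.

Lemma reflection_tr p : (reflection p)^T = reflection p.
Proof. by rewrite raddfB /= trmx1 linearZ /= trmx_mul trmxK. Qed.

Lemma reflectionK p :
  dotv p p != 0 -> reflection p *m reflection p = 1%:M.
Proof.
move=> p0; rewrite {2}/reflection mulmxBr mulmx1 -scalemxAr mulmxA reflectionE.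
rewrite divfK // -[X in X - _ *: p]scale1r -scalerBl -scalemxAl scalerA.
rewrite /reflection -addrA -opprD -scalerDl.
by rewrite mulrBr mulr1 mulr2n mulrDr mulr1 opprD addNKr subrr scale0r subr0.
Qed.

Lemma reflection_comm p B r :
  B^T = B -> B *m p = r *: p -> reflection p *m B = B *m reflection p.
Proof.
move=> sB Bp; rewrite mulmxBl mulmxBr mul1mx mulmx1 -scalemxAl -scalemxAr.
have pB : p^T *m B = r *: p^T by rewrite -[B in LHS]sB -trmx_mul Bp linearZ.
by rewrite mulmxA Bp -(mulmxA p) pB -scalemxAl -scalemxAr.
Qed.

(* On the plane spanned by [d] and [A d], the two reflections in the
   eigenvectors of [A] compose to a half-turn, and [d / 2] is the component of
   [t] in this plane. *)
Lemma commuting_half_turn A P d t r s :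
    A^T = A -> P^T = P -> A *m P = P *m A -> P *m d = - d ->
    A *m (A *m d) = (r + s) *: (A *m d) - (r * s) *: d -> r != s ->
    dotv d (A *m d) != r * dotv d d -> dotv d (A *m d) != s * dotv d d ->
    2 * dotv d t = dotv d d -> 2 * dotv (A *m d) t = dotv d (A *m d) ->
  exists H, [/\ H^T *m H = 1%:M, H *m A = A *m H, H *m P = P *m H & H *m t = t - d].
Proof.
move=> sA sP AP Pd Add rs nr ns dt Adt.
have eigen a c : A *m (A *m d) = (a + c) *: (A *m d) - (a * c) *: d ->
    A *m (A *m d - c *: d) = a *: (A *m d - c *: d).
  by move=> E; rewrite mulmxBr E -scalemxAr scalerBr !scalerA scalerDl addrAC addrK.
have eigenP c : P *m (A *m d - c *: d) = -1 *: (A *m d - c *: d).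
  by rewrite mulmxBr mulmxA -AP -mulmxA -scalemxAr Pd mulmxN scalerN scaleN1r opprB opprK addrC.
(* The [r]- and [s]-components of [d], scaled by [r - s] and [s - r]. They are orthogonal as
   eigenvectors of a symmetric matrix for distinct eigenvalues. *)
pose p := A *m d - s *: d; pose q := A *m d - r *: d.
have Ap : A *m p = r *: p by apply: eigen.
have Aq : A *m q = s *: q by apply: eigen; rewrite (addrC s) (mulrC s).
have rs0 : r - s != 0 by rewrite subr_eq0.
have pq : dotv p q = 0.
  apply: (mulfI rs0).
  by rewrite mulr0 mulrBl -dotvZl -Ap dotvM sA Aq dotvZr subrr.
have pqd : p - q = (r - s) *: d.
  by rewrite /p /q opprB addrC addrA subrK scalerBl.
pose x := dotv d (A *m d) - s * dotv d d.
pose y := dotv d (A *m d) - r * dotv d d.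
have pd : dotv p d = x by rewrite dotvC dotvBr dotvZr.
have qd : dotv q d = y by rewrite dotvC dotvBr dotvZr.
have pp : dotv p p = (r - s) * x.
  by rewrite -pd -dotvZr -pqd [in RHS]dotvBr pq subr0.
have qq : dotv q q = - ((r - s) * y).
  by rewrite -qd -dotvZr -pqd [in RHS]dotvBr (dotvC q p) pq sub0r opprK.
have x0 : x != 0 by rewrite subr_eq0.
have y0 : y != 0 by rewrite subr_eq0.
have pt : 2 * dotv p t = x by rewrite dotvBl dotvZl mulrBr Adt mulrCA dt.
have qt : 2 * dotv q t = y by rewrite dotvBl dotvZl mulrBr Adt mulrCA dt.
have p0 : dotv p p != 0 by rewrite pp mulf_neq0.
have q0 : dotv q q != 0 by rewrite qq oppr_eq0 mulf_neq0.
exists (reflection p *m reflection q); split.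
- by rewrite trmx_mul !reflection_tr mulmxA -(mulmxA (reflection q)) reflectionK //
    mulmx1 reflectionK.
- by rewrite -mulmxA (reflection_comm sA Aq) mulmxA (reflection_comm sA Ap) mulmxA.
- by rewrite -mulmxA (reflection_comm sP (eigenP r)) mulmxA
    (reflection_comm sP (eigenP s)) mulmxA.
(* By orthogonality the reflections subtract from [t] independently [p / (r - s)] and
   [- q / (r - s)], whose sum is [d]. *)
rewrite -mulmxA !reflectionE (dotvBr t) dotvZr pq mulr0 subr0.
have -> : 2 / dotv p p * dotv p t = (r - s)^-1.
  by rewrite mulrAC pt pp invfM mulrCA divff // mulr1.
have -> : 2 / dotv q q * dotv q t = - (r - s)^-1.
  by rewrite mulrAC qt qq invrN invfM mulrN mulrCA divff // mulr1.
rewrite scaleNr opprK -addrA -scalerBr -(opprB p q) scalerN pqd scalerA.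
by rewrite mulVf ?scale1r.
Qed.

End Reflections.

(** * Extending [H] from the odd vectors to an intertwiner of the whole space *)

Section Lift.

Variables (F : numFieldType) (n : nat) (A P H Dx Dy : 'M[F]_n) (ex ey : 'cV[F]_n).
Let one : 'cV[F]_n := const_mx 1.
Let tx := ex - P *m ex.
Let ty := ey - P *m ey.

Hypotheses (P_sym : P^T = P) (PP : P *m P = 1%:M) (AP : A *m P = P *m A).
Hypothesis A_half : A + A *m P = one *m one^T - 1%:M - P.
Hypotheses (Dx_sym : Dx^T = Dx) (DxDx : Dx *m Dx = 1%:M) (DxP : Dx *m P = - (P *m Dx)).
Hypotheses (Dy_sym : Dy^T = Dy) (DyDy : Dy *m Dy = 1%:M) (DyP : Dy *m P = - (P *m Dy)).
Hypotheses (Dxe : Dx *m ex = ex) (Dye : Dy *m ey = ey).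
Hypotheses (Dx1 : Dx *m one = tx + A *m tx) (Dy1 : Dy *m one = ty + A *m ty).
Hypotheses (HH : H^T *m H = 1%:M) (HA : H *m A = A *m H) (HP : H *m P = P *m H).
Hypothesis Htx : H *m tx = ty.

Let T : 'M[F]_n := 1%:M - P.
Let R : 'M[F]_n := H *m T.

(* [H] on the (-1)-eigenspace of [P]; as [Dx] and [Dy] swap the two eigenspaces
   of [P], the second summand transports [H] to the (+1)-eigenspace. *)
Definition lift_intertwiner : 'M[F]_n := 2^-1 *: (R + Dy *m R *m Dx).
Local Notation rho := lift_intertwiner.

Let PT : P *m T = - T.
Proof. by rewrite mulmxBr mulmx1 PP opprB. Qed.

Let TP : T *m P = - T.
Proof. by rewrite mulmxBl mul1mx PP opprB. Qed.

Let PR : P *m R = - R.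
Proof. by rewrite mulmxA -HP -mulmxA PT mulmxN. Qed.

Let RP : R *m P = - R.
Proof. by rewrite -mulmxA TP mulmxN. Qed.

Let self_opp m p (M : 'M[F]_(m, p)) : M = - M -> M = 0.
Proof.
move=> /eqP; rewrite -addr_eq0 -mulr2n -scaler_nat scaler_eq0 pnatr_eq0 /=.
by move/eqP.
Qed.

Let half m p (M : 'M[F]_(m, p)) : 2^-1 *: (M + M) = M.
Proof.
by rewrite -mulr2n -scaler_nat scalerA mulVf ?scale1r // pnatr_eq0.
Qed.

Lemma lift_intertwinerD : rho *m Dx = Dy *m rho.
Proof.
rewrite -scalemxAl -scalemxAr mulmxDl mulmxDr -(mulmxA _ Dx) DxDx mulmx1.
by rewrite (mulmxA Dy (Dy *m R)) (mulmxA Dy Dy) DyDy mul1mx addrC.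
Qed.

Let PDRD : P *m (Dy *m R *m Dx) = Dy *m R *m Dx.
Proof.
rewrite (mulmxA P (Dy *m R)) (mulmxA P Dy) -[P *m Dy]opprK -DyP mulNmx -(mulmxA Dy P R) PR.
by rewrite mulmxN opprK.
Qed.

Let DRDP : Dy *m R *m Dx *m P = Dy *m R *m Dx.
Proof.
rewrite -(mulmxA _ Dx P) DxP mulmxN mulmxA -(mulmxA Dy R P) RP.
by rewrite mulmxN mulNmx opprK.
Qed.

Lemma lift_intertwinerP : rho *m P = P *m rho.
Proof.
by rewrite -scalemxAl -scalemxAr mulmxDl mulmxDr RP PR PDRD DRDP.
Qed.

(** [Dx] makes an odd vector even, and [R] kills even vectors, so only the first summand of [rho]
    acts. *)
Lemma lift_intertwiner_odd (v : 'cV[F]_n) : P *m v = - v -> rho *m v = H *m v.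
Proof.
move=> Pv; have Tv : T *m v = v + v by rewrite mulmxBl mul1mx Pv opprK.
have RDv : R *m (Dx *m v) = 0.
  apply: self_opp; rewrite -{1}[v]opprK -Pv !mulmxN (mulmxA Dx) DxP mulNmx mulmxN opprK.
  by rewrite -(mulmxA P) (mulmxA R P) RP mulNmx.
rewrite -scalemxAl mulmxDl -[R *m v]mulmxA Tv -(mulmxA _ Dx v) -(mulmxA Dy R) RDv mulmx0 addr0.
by rewrite mulmxDr half.
Qed.

Let rhoT : rho *m T = R.
Proof.
rewrite mulmxBr mulmx1 lift_intertwinerP.
rewrite -scalemxAr -scalerBr mulmxDr PR PDRD.
by rewrite opprD opprK addrACA subrr addr0 half.
Qed.

Let Trho : T *m rho = R.
Proof. by rewrite -rhoT mulmxBl mulmxBr mul1mx mulmx1 lift_intertwinerP. Qed.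

Lemma lift_intertwiner_orthogonal : rho^T *m rho = 1%:M.
Proof.
have T_sym : T^T = T by rewrite raddfB /= trmx1 P_sym.
have TT : T *m T = T + T by rewrite mulmxBl mul1mx PT opprK.
have RtR : R^T *m R = T + T.
  by rewrite trmx_mul T_sym mulmxA -(mulmxA T) HH mulmx1 TT.
(* The range of [R] is odd and [Dy] makes it even; the two eigenspaces of the symmetric [P] are
   orthogonal. *)
have RDR : R^T *m Dy *m R = 0.
  have RtP : R^T *m P = - R^T by rewrite -[P in LHS]P_sym -trmx_mul PR raddfN.
  apply: self_opp; rewrite -[X in _ *m X = _]opprK -PR mulmxN (mulmxA _ P R).
  by rewrite -(mulmxA _ Dy P) DyP mulmxN mulNmx opprK (mulmxA _ P Dy) RtP !mulNmx.
(* Conjugation by [Dx] turns [1 - P] into [1 + P]. *)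
have DTD : T + Dx *m T *m Dx = 1%:M + 1%:M.
  by rewrite mulmxBr mulmx1 mulmxBl DxDx DxP mulNmx opprK -mulmxA DxDx mulmx1 addrACA addNr addr0.
have -> : rho^T = 2^-1 *: (R^T + Dx *m (R^T *m Dy)).
  by rewrite linearZ /= [in LHS]linearD /= (trmx_mul _ Dx) (trmx_mul Dy) Dx_sym Dy_sym.
rewrite -scalemxAl -scalemxAr.
rewrite mulmxDl !mulmxDr RtR (mulmxA R^T _ Dx) (mulmxA R^T Dy) RDR mul0mx addr0.
rewrite -(mulmxA Dx _ R) RDR mulmx0 add0r -(mulmxA Dx) (mulmxA (_ *m Dy) _ Dx).
rewrite -(mulmxA R^T Dy) (mulmxA Dy Dy R) DyDy mul1mx RtR.
by rewrite mulmxDl mulmxDr addrACA mulmxA DTD scalerDr half half.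
Qed.

Let P_tx : P *m tx = - tx.
Proof. by rewrite mulmxBr mulmxA PP mul1mx opprB. Qed.

Let rho_tx : rho *m tx = ty.
Proof. by rewrite lift_intertwiner_odd. Qed.

(** [D] turns the odd part of [e] into the even part, so [e] is recovered from its odd part. *)
Let D_t (D : 'M[F]_n) (e : 'cV[F]_n) : D *m P = - (P *m D) -> D *m e = e ->
  e + e = (e - P *m e) + D *m (e - P *m e).
Proof. by move=> DP De; rewrite mulmxBr mulmxA DP mulNmx -mulmxA De opprK addrACA addNr addr0. Qed.

Lemma lift_intertwiner_base : rho *m ex = ey.
Proof.
rewrite -[ey]half (D_t DyP Dye) -/ty -rho_tx mulmxA -lift_intertwinerD -mulmxA -mulmxDr.
by rewrite -(D_t DxP Dxe) mulmxDr half.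
Qed.

(** [Dx *m one] is the odd vector [tx + A *m tx], on which [rho] acts as [H], and [H] carries it to
    [ty + A *m ty = Dy *m one]. *)
Let rho_one : rho *m one = one.
Proof.
rewrite -[one in LHS]mul1mx -DxDx -mulmxA Dx1 mulmxA lift_intertwinerD.
rewrite -mulmxA mulmxDr rho_tx lift_intertwiner_odd; last first.
  by rewrite mulmxA -AP -mulmxA P_tx mulmxN.
by rewrite mulmxA HA -mulmxA Htx -Dy1 mulmxA DyDy mul1mx.
Qed.

Let one_rho : one^T *m rho = one^T.
Proof.
by rewrite -{1}rho_one trmx_mul -mulmxA lift_intertwiner_orthogonal mulmx1.
Qed.

Lemma lift_intertwinerA : rho *m A = A *m rho.
Proof.
(* [rho] commutes with the first term because [rho *m T = T *m rho = H *m T], and with the second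
   because it commutes with [P] and fixes [one] from both sides. *)
have A2 : A + A = A *m T + (one *m one^T - 1%:M - P).
  by rewrite -A_half mulmxBr mulmx1 addrCA subrK.
have AT : A *m T = T *m A by rewrite mulmxBl mulmxBr mul1mx mulmx1 AP.
rewrite -[LHS]half -[RHS]half -mulmxDr -mulmxDl A2 mulmxDr mulmxDl; congr (_ *: (_ + _)).
  by rewrite {1}AT mulmxA rhoT -(mulmxA A) Trho -(mulmxA H) -AT !mulmxA HA.
by rewrite !mulmxBr !mulmxBl mulmx1 mul1mx lift_intertwinerP mulmxA rho_one -mulmxA one_rho.
Qed.

Lemma lift_intertwiner_spec :
  [/\ rho^T *m rho = 1%:M, rho *m A = A *m rho, rho *m P = P *m rho,
      rho *m Dx = Dy *m rho & rho *m ex = ey].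
Proof.
split; [exact: lift_intertwiner_orthogonal | exact: lift_intertwinerA | |
  exact: lift_intertwinerD | exact: lift_intertwiner_base].
exact: lift_intertwinerP.
Qed.

End Lift.

(** For real [c] the discriminant [c ^+ 2 + 4 * m%:R] is positive, so the roots are distinct. *)
Lemma quadratic_roots (C : numClosedFieldType) (c : C) (m : nat) :
  c \is Num.real -> (0 < m)%N -> exists r s, [/\ r + s = c, r * s = - m%:R & r != s].
Proof.
move=> c_real m0; pose w := sqrtC (c ^+ 2 + 4 * m%:R).
have ww : w ^+ 2 = c ^+ 2 + 4 * m%:R by rewrite sqrtCK.
have w0 : w != 0.
  rewrite -sqrf_eq0 ww gt_eqF // ltr_wpDl ?real_exprn_even_ge0 //.
  by rewrite mulr_gt0 ?ltr0n.
exists ((c + w) / 2), ((c - w) / 2); split.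
- by field.
- have -> : m%:R = (w ^+ 2 - c ^+ 2) / 4 by rewrite ww; field.
  by field.
- apply: contra w0; rewrite -subr_eq0 => /eqP E; apply/eqP.
  by rewrite -E; field.
Qed.

(** * The matrices of a Taylor graph and their intertwiner *)

Section TaylorMatrices.

Variables (F : numClosedFieldType) (n : nat) (adj : rel 'I_n) (k b : nat).
Hypothesis taylor : taylor_graph adj k b.
Local Notation d := (dist adj).
Local Notation antipode := (antipode adj).
Implicit Types x y : 'I_n.

Let dist_lt x y : (d x y < n)%N := taylor_dist_lt x y taylor.
Let adj_sym := taylor_adj_sym taylor.
Let d_sym := dist_sym adj_sym dist_lt.
Let d_eq0 := dist_eq0 dist_lt.
Let d_eq1 := dist_eq1 dist_lt (taylor_adj_irr taylor).

Definition adjacency_mx : 'M[F]_n := \matrix_(i, j) (adj i j)%:R.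
Local Notation A := adjacency_mx.

Definition antipodal_mx : 'M[F]_n := \matrix_(i, j) (d i j == 3)%:R.
Local Notation P := antipodal_mx.

Definition side_mx x : 'M[F]_n := diag_mx (\row_j (-1) ^+ (1 < d x j)%N).

Definition unit_col x : 'cV[F]_n := delta_mx x 0.

Definition odd_col x : 'cV[F]_n := unit_col x - P *m unit_col x.

Lemma mul_antipodal_mx m (M : 'M[F]_(n, m)) i j : (P *m M) i j = M (antipode i) j.
Proof.
have -> : P = rowsub antipode 1%:M.
  by apply/matrixP => u v; rewrite !mxE (dist_eq3 taylor) eq_sym.
by rewrite -rowsubE mxE.
Qed.

Lemma antipodal_mx_sym : P^T = P.
Proof. by apply/matrixP => i j; rewrite !mxE d_sym. Qed.

Lemma mulmx_antipodal m (M : 'M[F]_(m, n)) i j : (M *m P) i j = M i (antipode j).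
Proof.
have -> : M *m P = (P *m M^T)^T by rewrite trmx_mul antipodal_mx_sym trmxK.
by rewrite mxE mul_antipodal_mx mxE.
Qed.

Lemma antipodal_mxK : P *m P = 1%:M.
Proof.
apply/matrixP => i j; rewrite mul_antipodal_mx !mxE (dist_antipode taylor) -d_eq0.
by have := taylor_dist_le3 taylor i j; case: (d i j) => [|[|[|[]]]].
Qed.

Lemma adjacency_mx_sym : A^T = A.
Proof. by apply/matrixP => i j; rewrite !mxE adj_sym. Qed.

Lemma adjacency_mx_antipodal : A *m P = P *m A.
Proof.
apply/matrixP => i j; rewrite mul_antipodal_mx mulmx_antipodal !mxE.
by rewrite adj_sym !(adj_antipode taylor) d_sym.
Qed.

(** [A *m P] is the distance-2 matrix, and every vertex other than [i] and its antipode is at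
    distance 1 or 2 from [i]. *)
Lemma adjacency_mx_half :
  A + A *m P = const_mx 1 *m (const_mx 1 : 'cV[F]_n)^T - 1%:M - P.
Proof.
apply/matrixP => i j; rewrite adjacency_mx_antipodal mxE mul_antipodal_mx !mxE.
rewrite big_ord1 !mxE mulr1 (adj_antipode taylor) -d_eq1 -d_eq0.
have := taylor_dist_le3 taylor i j; case: (d i j) => [|[|[|[]]]] //= _; ring.
Qed.

Lemma adjacency_mx_sqr :
  A *m A = k%:R%:M + (k - b - 1)%:R *: A + b%:R *: (P *m A).
Proof.
apply/matrixP => i j.
have -> : (A *m A) i j = #|[set l | adj i l && adj l j]|%:R.
  rewrite mxE -sum1dep_card natr_sum [RHS]big_mkcond.
  by apply: eq_bigr => l _; rewrite !mxE -natrM mulnb; case: ifP.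
rewrite (card_common_neighbors taylor) [RHS]mxE [X in _ = X + _]mxE.
rewrite [X in _ = _ + X]mxE mul_antipodal_mx !mxE (adj_antipode taylor) -d_eq1 -d_eq0.
have := taylor_dist_le3 taylor i j; case: (d i j) => [|[|[|[]]]] //= _; ring.
Qed.

Lemma side_mx_sym x : (side_mx x)^T = side_mx x.
Proof. exact: tr_diag_mx. Qed.

Lemma side_mxK x : side_mx x *m side_mx x = 1%:M.
Proof.
rewrite mulmx_diag -diag_const_mx; congr diag_mx.
by apply/rowP => j; rewrite !mxE -expr2 sqrr_sign.
Qed.

(** Of a vertex and its antipode, exactly one lies within distance 1 of [x]. *)
Lemma side_mx_antipodal x : side_mx x *m P = - (P *m side_mx x).
Proof.
apply/matrixP => i j; rewrite mul_diag_mx mul_mx_diag !mxE (dist_eq3 taylor).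
case: eqP => [->|_]; last by rewrite mulr0 mul0r oppr0.
rewrite (d_sym x (antipode i)) (dist_antipode taylor) (d_sym i x) mulr1 mul1r.
by have := taylor_dist_le3 taylor x i; case: (d x i) => [|[|[|[]]]] //= _; ring.
Qed.

Lemma mulmx_unit_col m (M : 'M[F]_(m, n)) x i : (M *m unit_col x) i 0 = M i x.
Proof. by rewrite -colE mxE. Qed.

Lemma side_mx_unit_col x : side_mx x *m unit_col x = unit_col x.
Proof.
apply/colP => i; rewrite mul_diag_mx !mxE eqxx andbT.
case: eqP => [->|_]; last by rewrite mulr0.
have /eqP-> : d x x == 0 by rewrite d_eq0.
exact: mul1r.
Qed.

Lemma mulmx_odd_col m (M : 'M[F]_(m, n)) x i :
  (M *m odd_col x) i 0 = M i x - M i (antipode x).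
Proof.
by rewrite mulmxBr mulmxA mxE mulmx_unit_col mxE mulmx_unit_col mulmx_antipodal.
Qed.

Lemma antipodal_odd_col x : P *m odd_col x = - odd_col x.
Proof. by rewrite mulmxBr mulmxA antipodal_mxK mul1mx opprB. Qed.

(** [odd_col x] is 1 at [x] and -1 at its antipode; [A *m odd_col x] is 1 at distance 1 and -1 at
    distance 2. *)
Lemma side_mx_one x : side_mx x *m const_mx 1 = odd_col x + A *m odd_col x.
Proof.
apply/colP => i; rewrite mul_diag_mx -{1}[odd_col x]mul1mx.
rewrite [RHS]mxE !mulmx_odd_col !mxE mulr1 -!d_eq0.
rewrite (adj_sym i (antipode x)) (adj_antipode taylor) -d_eq1.
rewrite (d_sym i (antipode x)) (dist_antipode taylor) (d_sym i x).
have := taylor_dist_le3 taylor x i; case: (d x i) => [|[|[|[]]]] //= _; ring.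
Qed.

(** Moving [1 - P] from [unit_col x] across [M] onto [odd_col y] doubles the latter. *)
Lemma dotv_odd_col (M : 'M[F]_n) x y : M *m P = P *m M ->
  dotv (odd_col x) (M *m odd_col y) = 2 * (M x y - M x (antipode y)).
Proof.
move=> MP; have -> : odd_col x = (1%:M - P) *m unit_col x by rewrite mulmxBl mul1mx.
rewrite dotvM raddfB /= trmx1 antipodal_mx_sym mulmxBl mul1mx !mulmxA -MP.
rewrite -(mulmxA M P) antipodal_odd_col mulmxN opprK.
rewrite /dotv trmx_delta -rowE mxE mxE mulmx_odd_col; ring.
Qed.

Lemma adjacency_mx_sqr_odd_col x :
  A *m (A *m odd_col x) =
  ((k - b - 1)%:R - b%:R) *: (A *m odd_col x) + k%:R *: odd_col x.
Proof.
rewrite mulmxA adjacency_mx_sqr !mulmxDl mul_scalar_mx -!scalemxAl -adjacency_mx_antipodal.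
rewrite -(mulmxA A P) antipodal_odd_col mulmxN scalerN scalerBl.
by rewrite -addrA addrC.
Qed.

(** For [t = odd_col x - odd_col y] the two sides are a quarter of [dotv t (A *m t)] and of
    [r * dotv t t]. Their difference makes the component of [t] for the other root anisotropic. *)
Lemma taylor_norm_neq0 (r : F) x y :
  r ^+ 2 = ((k - b - 1)%:R - b%:R) * r + k%:R -> x != y ->
  - (A x y - A x (antipode y)) != r *
      (1 - ((1%:M : 'M[F]_n) x y - (1%:M : 'M[F]_n) x (antipode y))).
Proof.
have bk := taylor_k_gt taylor; have b0 := taylor_b_gt0 taylor.
have -> : (k - b - 1)%:R = k%:R - b%:R - 1 :> F by rewrite !natrB //; lia.
move=> rr; rewrite -d_eq0 !mxE -!d_eq0 (adj_sym x (antipode y)) (adj_antipode taylor) -d_eq1.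
rewrite (d_sym x (antipode y)) (dist_antipode taylor) (d_sym y x).
(* Equality at distance 1, 2, 3 forces [r] to be -1, 1, 0, and the quadratic equation then gives
   [b = 0], [k = b + 1], [k = 0]. *)
have := taylor_dist_le3 taylor x y; case: (d x y) => [|[|[|[]]]] //= _ _; apply/eqP => E.
- have r1 : r = -1 by move: E; rewrite subr0 subr0 subr0 mulr1.
  have : (2 * b)%:R = 0 :> F.
    by rewrite natrM; apply: (etrans _ (subrr (r ^+ 2))); rewrite {1}rr r1; ring.
  by move/eqP; rewrite pnatr_eq0; lia.
- have r1 : r = 1 by move: E; rewrite sub0r opprK subr0 subr0 mulr1.
  have : (2 * (k - b.+1))%:R = 0 :> F.
    rewrite natrM natrB; last by lia.
    by rewrite -natr1; apply: (etrans _ (subrr (r ^+ 2))); rewrite {1}rr r1; ring.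
  by move/eqP; rewrite pnatr_eq0; lia.
- have r0 : r = 0.
    move/esym/eqP: E; rewrite subr0 oppr0 sub0r opprK mulf_eq0 -[1 + 1]/2%:R.
    by rewrite pnatr_eq0 orbF => /eqP.
  have : k%:R = 0 :> F by rewrite -[RHS](subrr (r ^+ 2)) {1}rr r0; ring.
  by move/eqP; rewrite pnatr_eq0; lia.
Qed.

Lemma taylor_intertwiner x y : exists rho : 'M[F]_n,
  [/\ rho^T *m rho = 1%:M, rho *m A = A *m rho, rho *m P = P *m rho,
      rho *m side_mx x = side_mx y *m rho & rho *m unit_col x = unit_col y].
Proof.
(* For [x = y] the vector [t] below is zero and no reflection is available. *)
have [<-|xy] := eqVneq x y.
  by exists 1%:M; rewrite trmx1 !mul1mx !mulmx1.
have c_real : (k - b - 1)%:R - b%:R \is @Num.real F by rewrite rpredB ?realn.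
have k0 : (0 < k)%N by have := taylor_k_gt taylor; lia.
have [r [s [rs_sum rs_prod rs]]] := quadratic_roots c_real k0.
have r_root : r ^+ 2 = ((k - b - 1)%:R - b%:R) * r + k%:R.
  by rewrite -rs_sum -[k%:R]opprK -rs_prod; ring.
have s_root : s ^+ 2 = ((k - b - 1)%:R - b%:R) * s + k%:R.
  by rewrite -rs_sum -[k%:R]opprK -rs_prod; ring.
pose t := odd_col x - odd_col y.
have dot1 u v := dotv_odd_col u v (etrans (mul1mx P) (esym (mulmx1 P))).
have dotA u v := dotv_odd_col u v adjacency_mx_antipodal.
pose one : 'M[F]_n := 1%:M; pose tau := one x y - one x (antipode y).
pose sig := A x y - A x (antipode y).
have one_diag z : one z z - one z (antipode z) = 1.
  rewrite !mxE eqxx -d_eq0 (d_sym z) (dist_antipode taylor).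
  have /eqP-> : d z z == 0%N by rewrite d_eq0.
  exact: subr0.
have A_diag z : A z z - A z (antipode z) = 0.
  rewrite !mxE -!d_eq1 (d_sym z (antipode z)) (dist_antipode taylor).
  have /eqP-> : d z z == 0%N by rewrite d_eq0.
  exact: subr0.
have xx1 z : dotv (odd_col z) (odd_col z) = 2.
  by rewrite -[X in dotv _ X]mul1mx dot1 one_diag mulr1.
have xy1 : dotv (odd_col x) (odd_col y) = 2 * tau.
  by rewrite -[X in dotv _ X]mul1mx dot1.
have xxA z : dotv (odd_col z) (A *m odd_col z) = 0.
  by rewrite dotA A_diag mulr0.
have xyA : dotv (odd_col x) (A *m odd_col y) = 2 * sig by rewrite dotA.
have yxA : dotv (odd_col y) (A *m odd_col x) = 2 * sig.
  by rewrite dotvC dotvM adjacency_mx_sym.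
have dotvtl v : dotv t v = dotv (odd_col x) v - dotv (odd_col y) v by exact: dotvBl.
have dotvtr v : dotv v t = dotv v (odd_col x) - dotv v (odd_col y) by exact: dotvBr.
have At : A *m t = A *m odd_col x - A *m odd_col y by exact: mulmxBr.
have tt : dotv t t = 4 * (1 - tau).
  by rewrite dotvtl !dotvtr !xx1 xy1 (dotvC _ (odd_col x)) xy1; ring.
have tAt : dotv t (A *m t) = 4 * (- sig).
  by rewrite At dotvtl !(dotvBr (A *m odd_col x)) !xxA xyA yxA; ring.
have norm c : c ^+ 2 = ((k - b - 1)%:R - b%:R) * c + k%:R ->
    dotv t (A *m t) != c * dotv t t.
  move=> /taylor_norm_neq0 /(_ xy); rewrite tt tAt mulrCA.
  by apply: contraNN => /eqP/(mulfI _)->; rewrite ?pnatr_eq0.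
have Pt : P *m t = - t by rewrite (mulmxBr P (odd_col x)) !antipodal_odd_col -opprD.
have AAt : A *m (A *m t) = (r + s) *: (A *m t) - (r * s) *: t.
  rewrite rs_sum rs_prod scaleNr opprK At (mulmxBr A (A *m odd_col x)) !adjacency_mx_sqr_odd_col.
  by rewrite !scalerBr opprD addrACA.
(* [odd_col x] and [odd_col y] have the same norm, for [dotv] and, in [Atx], for the form of [A]. *)
have tx : 2 * dotv t (odd_col x) = dotv t t.
  by rewrite tt dotvtl xx1 (dotvC (odd_col y)) xy1; ring.
have Atx : 2 * dotv (A *m t) (odd_col x) = dotv t (A *m t).
  by rewrite tAt dotvM adjacency_mx_sym dotvtl xxA yxA; ring.
have [H [HH HA HP Ht]] := commuting_half_turn adjacency_mx_sym antipodal_mx_sym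
  adjacency_mx_antipodal Pt AAt rs (norm _ r_root) (norm _ s_root) tx Atx.
have {}Ht : H *m odd_col x = odd_col y by rewrite Ht opprB addrC subrK.
exists (lift_intertwiner P H (side_mx x) (side_mx y)).
exact: (lift_intertwiner_spec antipodal_mx_sym antipodal_mxK adjacency_mx_antipodal
  adjacency_mx_half (side_mx_sym x) (side_mxK x) (side_mx_antipodal x)
  (side_mx_sym y) (side_mxK y) (side_mx_antipodal y) (side_mx_unit_col x)
  (side_mx_unit_col y) (side_mx_one x) (side_mx_one y) HH HA HP Ht).
Qed.

(** Over [Cx] this is [Estar] by conversion, as [adjacency_mx] is [Amx]; the final theorem relies on
    both. *)
Definition sphere_mx x i : 'M[F]_n := \matrix_(y, z) ((y == z) && (d x y == i))%:R.

Lemma sphere_mx0 x : sphere_mx x 0 = unit_col x *m (unit_col x)^T.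
Proof.
rewrite trmx_delta mul_delta_mx; apply/matrixP => i j; rewrite !mxE d_eq0.
by rewrite andbC (eq_sym x i); case: (eqVneq i x) => [->|//]; rewrite (eq_sym x).
Qed.

Lemma sphere_mx3 x : sphere_mx x 3 = P *m sphere_mx x 0 *m P.
Proof.
apply/matrixP => i j; rewrite mulmx_antipodal mul_antipodal_mx !mxE.
rewrite (inj_eq (can_inj (antipodeK taylor))) (d_sym x (antipode i)).
rewrite (dist_antipode taylor) (d_sym i x).
by have := taylor_dist_le3 taylor x i; case: (d x i) => [|[|[|[]]]].
Qed.

Lemma sphere_mx1 x : sphere_mx x 1 = 2^-1 *: (1%:M + side_mx x) - sphere_mx x 0.
Proof.
apply/matrixP => i j; rewrite !mxE; case: eqP => [_|_] /=; last by rewrite !mulr0n; field.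
by have := taylor_dist_le3 taylor x i; case: (d x i) => [|[|[|[]]]] //= _; field.
Qed.

Lemma sphere_mx2 x : sphere_mx x 2 = 2^-1 *: (1%:M - side_mx x) - sphere_mx x 3.
Proof.
apply/matrixP => i j; rewrite !mxE; case: eqP => [_|_] /=; last by rewrite !mulr0n; field.
by have := taylor_dist_le3 taylor x i; case: (d x i) => [|[|[|[]]]] //= _; field.
Qed.

Lemma taylor_sphere_intertwiner x y : exists rho : 'M[F]_n,
  [/\ rho \in unitmx, rho *m A = A *m rho &
      forall i, (i <= 3)%N -> rho *m sphere_mx x i = sphere_mx y i *m rho].
Proof.
have [rho [orth rhoA rhoP rhoD rhoe]] := taylor_intertwiner x y.
exists rho; split => //; first by case: (mulmx1_unit orth).
(* The matrix has rank one, and orthogonality turns [rho *m unit_col x = unit_col y] into the row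
   identity needed on the right. *)
have E0 : rho *m sphere_mx x 0 = sphere_mx y 0 *m rho.
  rewrite !sphere_mx0 mulmxA rhoe -mulmxA -rhoe; congr (_ *m _).
  by rewrite trmx_mul -mulmxA orth mulmx1.
have E3 : rho *m sphere_mx x 3 = sphere_mx y 3 *m rho.
  by rewrite !sphere_mx3 !mulmxA rhoP -!mulmxA -rhoP !mulmxA -(mulmxA P) E0 !mulmxA.
case=> [|[|[|[|//]]]] _ //.
  by rewrite !sphere_mx1 mulmxBr mulmxBl E0 -scalemxAr -scalemxAl
    mulmxDr mulmxDl mulmx1 mul1mx rhoD.
by rewrite !sphere_mx2 mulmxBr mulmxBl E3 -scalemxAr -scalemxAl
  mulmxBr mulmxBl mulmx1 mul1mx rhoD.
Qed.

End TaylorMatrices.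

(** * From the module isomorphism to the algebra isomorphism *)

Section Conjugation.

Variables (n : nat) (adj : rel 'I_n) (D : nat).
Implicit Types (x y : 'I_n) (rho M : 'M[Cx]_n).

Lemma inTer_conj x y rho M : rho \in unitmx ->
    rho *m Amx adj = Amx adj *m rho ->
    (forall i, (i <= D)%N -> rho *m Estar adj x i = Estar adj y i *m rho) ->
  inTer adj D x M -> inTer adj D y (rho *m M *m invmx rho).
Proof.
move=> rhoU rhoA rhoE; elim=> {M}.
- by rewrite rhoA mulmxK //; apply: inTer_A.
- by move=> i iD; rewrite rhoE // mulmxK //; apply: inTer_E.
- by rewrite mulmx1 mulmxV //; apply: inTer_1.
- by move=> M N _ IM _ IN; rewrite mulmxDr mulmxDl; apply: inTer_add.
- by move=> a M _ IM; rewrite -scalemxAr -scalemxAl; apply: inTer_scale.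
- move=> M N _ IM _ IN; have := inTer_mul IM IN.
  by rewrite !mulmxA mulmxKV.
Qed.

Lemma module_iso_Ter_iso x y : module_iso adj D x y -> Ter_iso adj D x y.
Proof.
case=> rho [rhoU rhoA rhoE]; exists (fun M => rho *m M *m invmx rho); split.
- by move=> M; apply: inTer_conj.
- by move=> a M N _ _; rewrite mulmxDr mulmxDl -scalemxAr -scalemxAl.
- by move=> M N _ _; rewrite !mulmxA mulmxKV.
- by rewrite mulmx1 mulmxV.
split.
- move=> M N _ _ /(can_inj (mulmxKV rhoU)); exact: (can_inj (mulKmx rhoU)).
- move=> N TN; exists (invmx rho *m N *m rho); last first.
    by rewrite !mulmxA mulmxV // mul1mx mulmxK.
  (* The preimage lies in the algebra of [x] because [invmx rho] intertwines in the opposite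
     direction. *)
  rewrite -[X in _ *m X]invmxK; apply: inTer_conj TN; rewrite ?unitmx_inv //.
    by rewrite -[RHS](mulKmx rhoU) (mulmxA rho) rhoA -!mulmxA mulmxV // mulmx1.
  move=> i iD.
  by rewrite -[RHS](mulKmx rhoU) (mulmxA rho) rhoE // -!mulmxA mulmxV // mulmx1.
- by rewrite rhoA mulmxK.
- by move=> i iD; rewrite rhoE // mulmxK.
Qed.

End Conjugation.

Theorem theorem7p6 (n : nat) (adj : rel 'I_n) (k b : nat) :
  taylor_graph adj k b -> pseudo_vertex_transitive adj 3.
Proof.
move=> taylor x y.
have rho : module_iso adj 3 x y := taylor_sphere_intertwiner Cx taylor x y.
by split=> //; apply: module_iso_Ter_iso.
Qed.
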